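(* Let $\mathcal{A}$ be $\mathcal{C}_n$, $\mathcal{H}_n$ or $\mathbf{\Gamma}_n$, and let $\mathrm{Log}$ be any inverse to the exponential function in $\mathcal{A}$, i.e. a function $\mathrm{Log}: X\subseteq\mathrm{Ld}(\mathcal{A})\to\mathcal{A}$ with $e^{\mathrm{Log}(z)} = z$ for all $z\in X$. Then $\mathrm{Re}(\mathrm{Log}(z)) = \log(|z|)$ for all $z \in X$.
   Context: $\mathcal{H}_n = \mathbb{R}[j]/\langle j^n-1\rangle$, $\mathcal{C}_n = \mathbb{R}[i]/\langle i^n+1\rangle$, $\mathbf{\Gamma}_n = \mathbb{R}[\epsilon]/\langle\epsilon^n\rangle$; $k$ denotes the respective generator $j,i,\epsilon$, and $\beta = \{1,k,\dots,k^{n-1}\}$. The exponential on $\mathcal{A}$ is $e^z=\sum_{m=0}^\infty z^m/m!$ and $\mathrm{Ld}(\mathcal{A})$ is the image of $\exp:\mathcal{A}\to\mathcal{A}$. $M_\beta(z)$ is the matrix with respect to $\beta$ of left-multiplication $x\mapsto zx$, $F(z)=\det(M_\beta(z))$, and the $\mathcal{A}$-modulus of $z\in\mathrm{Ld}(\mathcal{A})$ is $|z| = \sqrt[n]{F(z)}$ (on $\mathrm{Ld}(\mathcal{A})$ one has $F(z)>0$, and the positive real $n$-th root is taken). For $w = x_1 + kx_2+\dots+k^{n-1}x_n$ with $x_i\in\mathbb{R}$, $\mathrm{Re}(w) = x_1$. On positive reals, $\log$ is the usual real logarithm. *)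

(* Defs.v *)
From HB Require Import structures.
From mathcomp Require Import all_boot all_order all_algebra.
From mathcomp Require Import all_classical all_reals all_analysis.

Set Implicit Arguments.
Unset Strict Implicit.
Unset Printing Implicit Defensive.

Import Order.TTheory GRing.Theory Num.Theory.
Import numFieldNormedType.Exports.
Local Open Scope classical_set_scope.
Local Open Scope ring_scope.

(* The library quotients by [mk_monic h], which is [h] only when [h] is monic  *)
(* of positive degree. For [0 < n] this is the case of the three polynomials   *)
(* defining H_n, C_n and Gamma_n, so that {poly %/ h} is the intended R[k]/(h) *)
(* with k = 'qX; its elements are polynomials of degree < n, whose             *)
(* coefficients are the coordinates in the basis 1, k, ..., k^(n-1).           *)
Lemma mk_monicXn_add1 (R : nzRingType) (n : nat) (hn : (0 < n)%N) :
  mk_monic ('X^n + 1) = 'X^n + 1 :> {poly R}.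
Proof. by rewrite /mk_monic -polyC1 size_XnaddC // monicXnaddC // ltnS hn. Qed.

Lemma mk_monicXn_sub1 (R : nzRingType) (n : nat) (hn : (0 < n)%N) :
  mk_monic ('X^n - 1) = 'X^n - 1 :> {poly R}.
Proof. by rewrite /mk_monic -polyC1 size_XnsubC // monicXnsubC // ltnS hn. Qed.

Lemma mk_monicXn (R : nzRingType) (n : nat) (hn : (0 < n)%N) :
  mk_monic 'X^n = 'X^n :> {poly R}.
Proof. by rewrite mk_monic_Xn prednK. Qed.

Section QuotientAlgebra.
Context {R : realType} {h : {poly R}}.
Implicit Types z : {poly %/ h}.

Definition qexp_partial z (N : nat) : {poly %/ h} :=
  \sum_(0 <= m < N) (m`!%:R : R)^-1 *: z ^+ m.

(* The limit is taken in the row vectors of coordinates, which carry the usual *)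
(* topology of a finite-dimensional real vector space.                         *)
Definition qexp z : {poly %/ h} :=
  rVnpoly (lim ((fun N => npoly_rV (qexp_partial z N)) @ \oo)).

Definition Ld : set {poly %/ h} := range qexp.

(* Column j holds the coordinates of z * k^j. *)
Definition mulmat (n : nat) z : 'M[R]_n :=
  \matrix_(i < n, j < n) (z * 'qX ^+ j)`_i.

Definition qdet (n : nat) z : R := \det (mulmat n z).

(* On [Ld], where [qdet n] is positive, this is the positive n-th root. *)
Definition modulus (n : nat) z : R := qdet n z `^ (n%:R)^-1.

Definition qRe z : R := z`_0.

End QuotientAlgebra.

Arguments Ld {R} h.

(* Main.v *)
Require Import Defs.
From HB Require Import structures.
From mathcomp Require Import all_boot all_order all_algebra.
From mathcomp Require Import all_classical all_reals all_analysis.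

Set Implicit Arguments.
Unset Strict Implicit.
Unset Printing Implicit Defensive.

Import Order.TTheory GRing.Theory Num.Theory.
Import numFieldNormedType.Exports.
Local Open Scope classical_set_scope.
Local Open Scope ring_scope.

(* Left multiplication turns the theorem into a statement on real matrices:    *)
(* F(e^w) = det (e^A) with A = M_beta(w). To see that det (e^A) = e^(tr A)     *)
(* without complex eigenvalues, approximate e^A by (1 + A/N)^N, for which      *)
(* det ((1 + A/N)^N) = (1 + tr A / N + O(1/N^2))^N tends to e^(tr A).          *)
(* Finally k^n is a real constant c in each of the three algebras, so that     *)
(* multiplication by k^l has zero diagonal for 0 < l < n; hence tr A =         *)
(* n Re(w), and F(e^w) = e^(n Re(w)).                                          *)

(** The limit argument rests on [cvg_exprmx] (the powers of [1 + A/N] tend to the matrix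
    exponential), [det_1DZ] and [cvg_onePXn], joined in [det_mxexp]; [det_mulmat_qexp] carries it
    over to the algebra, and [mxtrace_mulmat] computes the trace. *)

Lemma cvg_onePXn (R : realType) (x : R ^nat) (a : R) :
  N%:R * x N @[N --> \oo] --> a -> (1 + x N) ^+ N @[N --> \oo] --> expR a.
Proof.
move=> xa.
have x0 : x @ \oo --> (0 : R).
  rewrite -cvg_shiftS /=; move: xa; rewrite -cvg_shiftS => /(cvgM cvg_harmonic).
  rewrite mul0r; apply: cvg_trans; apply: near_eq_cvg; near=> N.
  by rewrite /= mulrA mulVf ?mul1r.
have D1 : 1 + x N @[N --> \oo] --> (1 : R).
  by rewrite -[X in _ --> X]addr0; apply: cvgD => //; exact: cvg_cst.
have D0 : \forall N \near \oo, 0 < 1 + x N.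
  by apply: (cvgr_gt (1 : R)) => //; exact: ltr01.
have cexp (y : R ^nat) : y @ \oo --> a -> expR (y N) @[N --> \oo] --> expR a.
  by move=> ya; apply: continuous_cvg => //; exact: continuous_expR.
(* Both bounds come from [1 + y <= expR y]: at [y = x N], and at [y = - x N / (1 + x N)], which
   gives [expR (x N / (1 + x N)) <= 1 + x N]. *)
apply: (@squeeze_cvgr _ _ _ _
    (fun N => expR (N%:R * x N / (1 + x N))) (fun N => expR (N%:R * x N))).
- near=> N; have xN : 0 < 1 + x N by near: N.
  rewrite -mulrA !expRM_natl; apply/andP; split.
    apply: lerXn2r; rewrite ?nnegrE ?expR_ge0 ?(ltW xN)//.
    rewrite -[leRHS]invrK -[leLHS]invrK lef_pV2 ?posrE ?invr_gt0 ?expR_gt0//.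
    rewrite -expRN; apply: le_trans (expR_ge1Dx _).
    suff -> : 1 - x N / (1 + x N) = (1 + x N)^-1 by [].
    apply: (mulIf (lt0r_neq0 xN)).
    by rewrite mulrBl mulfVK ?mulVf ?lt0r_neq0// mul1r addrK.
  by apply: lerXn2r; rewrite ?nnegrE ?expR_ge0 ?(ltW xN)// expR_ge1Dx.
- apply: cexp; rewrite -[X in _ --> X]divr1; apply: cvgM => //.
  by apply: cvgV => //; exact: oner_neq0.
- exact: cexp.
Unshelve. all: by end_near. Qed.

Lemma det_1DZ (R : fieldType) (n : nat) (A : 'M[R]_n) :
  exists r : {poly R}, r.[0] = \tr A /\
    forall t, t != 0 -> \det (1%:M + t *: A) = 1 + t * r.[t].
Proof.
case: n A => [|n] A.
  exists 0; rewrite horner0 /mxtrace big_ord0; split => // t _.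
  by rewrite det_mx00 horner0 mulr0 addr0.
set c := char_poly (- A).
(* [det (1 + tA) = t^(n+1) c(1/t)] reverses the coefficients of [c]: the leading 1 becomes the
   constant term, and the next one, [tr A], becomes [r.[0]]. *)
exists (\poly_(i < n.+1) c`_(n - i)); split.
  by rewrite horner_coef0 coef_poly subn0 char_poly_trace// linearN opprK.
move=> t t0.
have -> : 1%:M + t *: A = t *: (t^-1%:M + A).
  by rewrite scalerDr scale_scalar_mx divff.
have cE s : \det (s%:M + A) = c.[s].
  rewrite -horner_evalE -det_map_mx; congr (\det _); apply/matrixP => i j.
  by rewrite !mxE /= horner_evalE !hornerE hornerMn hornerX opprK.
rewrite detZ cE (@horner_coef_wide _ n.+2) ?size_char_poly// big_ord_recr /=.
have -> : c`_n.+1 = 1.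
  by have /monicP := char_poly_monic (- A); rewrite /lead_coef size_char_poly.
rewrite mul1r mulrDr -exprMn divff// expr1n addrC; congr (1 + _).
rewrite horner_poly !big_distrr/= [RHS](reindex_inj rev_ord_inj)/=.
have le_in (i : 'I_n.+1) : (i <= n)%N by rewrite -ltnS.
apply: eq_bigr => i _; rewrite subSS subKn// mulrCA [RHS]mulrCA.
congr (_ * _); rewrite -exprS.
rewrite -[X in X * _](_ : t ^+ ((n - i).+1 + i) = _); last first.
  by rewrite addSn subnK.
by rewrite exprD -mulrA -exprMn divff// expr1n mulr1.
Qed.

(** * Limits of matrices and determinants, entry by entry *)

Section EntrywiseConvergence.
Context (R : realType) (T : Type) (F : set_system T) (FF : Filter F).

Lemma cvg_mx m n (A : T -> 'M[R]_(m, n)) (B : 'M[R]_(m, n)) :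
  (forall i j, A t i j @[t --> F] --> B i j) -> A t @[t --> F] --> B.
Proof.
move=> AB S [P BP PS]; near=> t; apply: PS => i j; move: i j.
near: t; apply: filter_forall => i; apply: filter_forall => j.
exact: AB (BP i j).
Unshelve. all: by end_near. Qed.

Lemma cvg_det n (A : T -> 'M[R]_n) (B : 'M[R]_n) :
  (forall i j, A t i j @[t --> F] --> B i j) ->
  \det (A t) @[t --> F] --> \det B.
Proof.
move=> AB; apply: cvg_big => [|s _]; first exact: add_continuous.
apply: cvgM; first exact: cvg_cst.
by apply: cvg_big => [|i _]; [exact: mul_continuous|exact: AB].
Qed.

End EntrywiseConvergence.

(** * The exponential of a real matrix and its determinant *)

Section MatrixExponential.
Context (R : realType) (n : nat).
Implicit Types A L : 'M[R]_n.

Let mxsum A : R := \sum_i \sum_j `|A i j|.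

Let mxsum_ge0 A : 0 <= mxsum A.
Proof. by do 2 apply: sumr_ge0 => ? _. Qed.

Lemma normr_expmx_le A m i j : `|(A ^+ m) i j| <= mxsum A ^+ m.
Proof.
elim: m i j => [|m IHm] i j.
  rewrite !expr0 [1](_ : _ = 1%:M)// mxE.
  by case: (i == j); rewrite ?normr1 ?normr0.
rewrite exprS [A * _](_ : _ = A *m A ^+ m)// mxE exprS.
apply: le_trans (ler_norm_sum _ _ _) _.
apply: (@le_trans _ _ (\sum_k `|A i k| * mxsum A ^+ m)).
  by apply: ler_sum => k _; rewrite normrM ler_wpM2l.
rewrite -big_distrl ler_wpM2r ?exprn_ge0//= /mxsum [leRHS](bigD1 i)//= lerDl.
by do 2 apply: sumr_ge0 => ? _.
Qed.

Lemma mxexp_coordE A (i j : 'I_n) :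
  (fun N => (\sum_(0 <= m < N) (m`!%:R)^-1 *: A ^+ m) i j) =
  series (fun m => (m`!%:R)^-1 * (A ^+ m) i j).
Proof.
by apply/funext => N; rewrite summxE; apply: eq_bigr => m _; rewrite mxE.
Qed.

(** Absolute convergence, by comparison with the exponential series of [mxsum A]. *)
Lemma is_cvg_mxexp_coord A (i j : 'I_n) :
  cvgn (fun N => (\sum_(0 <= m < N) (m`!%:R)^-1 *: A ^+ m) i j).
Proof.
rewrite mxexp_coordE; apply: (@normed_cvg _ R^o).
apply: (series_le_cvg _ _ _ (is_cvg_series_exp_coeff (mxsum A))) => m //=.
  by rewrite mulr_ge0 ?exprn_ge0.
rewrite normrM ger0_norm// mulrC; apply: ler_wpM2r => //.
exact: normr_expmx_le.
Qed.

Lemma exprmx_1DZ A (t : R) N :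
  (1 + t *: A) ^+ N = \sum_(0 <= m < N.+1) (t ^+ m *+ 'C(N, m)) *: A ^+ m.
Proof.
rewrite addrC exprD1n big_mkord; apply: eq_bigr => m _.
rewrite -scalerMnl; congr (_ *+ _).
elim: (nat_of_ord m) => [|k IHk]; first by rewrite !expr0 scale1r.
rewrite !exprS IHk.
rewrite [LHS](_ : _ = (t *: A) *m (t ^+ k *: A ^+ k))//.
by rewrite -scalemxAl -scalemxAr scalerA.
Qed.

(** [C(N, m) m!] is the falling factorial [N (N-1) ... (N-m+1)], which is at most [N^m]. *)
Lemma bin_expV_le_factV (N m : nat) :
  (N%:R^-1 ^+ m *+ 'C(N, m) : R) <= (m`!%:R)^-1.
Proof.
rewrite -mulr_natr -[leRHS]mul1r ler_pdivlMr ?ltr0n ?fact_gt0//.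
rewrite -mulrA -natrM bin_ffact.
case: N => [|N]; first by case: m => [|m]; rewrite ?mul1r// mulr0n mulr0.
rewrite exprVn mulrC ler_pdivrMr ?exprn_gt0// mul1r -natrX ler_nat.
elim: m => // m IHm; rewrite ffactnSr expnSr; apply: leq_mul => //.
exact: leq_subr.
Qed.

(* The coefficients [1/m! - C(N, m)/N^m] are nonnegative, so the difference    *)
(* between the two approximations of [exp A] is dominated entrywise by the     *)
(* difference between the corresponding approximations of a real exponential.  *)
Lemma mxexp_sub_exprmx_le A N i j :
  `|(\sum_(0 <= m < N.+1) (m`!%:R)^-1 *: A ^+ m
     - (1 + N%:R^-1 *: A) ^+ N) i j| <=
  series (exp_coeff (mxsum A)) N.+1 - (1 + N%:R^-1 * mxsum A) ^+ N.
Proof.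
rewrite exprmx_1DZ -sumrB summxE.
apply: le_trans (ler_norm_sum _ _ _) _.
rewrite [1 + _]addrC exprD1n -(big_mkord xpredT
  (fun m => (N%:R^-1 * mxsum A) ^+ m *+ 'C(N, m))) -sumrB.
apply: ler_sum => m _.
rewrite -scalerBl mxE normrM ger0_norm ?subr_ge0 ?bin_expV_le_factV//.
rewrite exp_coeffE /= exprMn -mulrnAl -mulrBl.
by rewrite ler_wpM2l ?subr_ge0 ?bin_expV_le_factV ?normr_expmx_le.
Qed.

(** Both terms of the bound in [mxexp_sub_exprmx_le] tend to [expR (mxsum A)], so the error
    vanishes. *)
Lemma cvg_exprmx A L :
  (forall i j, (\sum_(0 <= m < N) (m`!%:R)^-1 *: A ^+ m) i j
     @[N --> \oo] --> L i j) ->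
  forall i j, ((1 + N%:R^-1 *: A) ^+ N) i j @[N --> \oo] --> L i j.
Proof.
move=> EL i j.
have dom0 : series (exp_coeff (mxsum A)) N.+1
    - (1 + N%:R^-1 * mxsum A) ^+ N @[N --> \oo] --> 0.
  rewrite -(subrr (expR (mxsum A))); apply: cvgB.
    by rewrite (cvg_shiftS (series _)); exact: is_cvg_series_exp_coeff.
  apply: cvg_onePXn; rewrite -cvg_shiftS /=.
  under eq_fun do rewrite mulrA mulfV ?mul1r//.
  exact: cvg_cst.
rewrite -[L i j](subr0).
have : (\sum_(0 <= m < N.+1) (m`!%:R)^-1 *: A ^+ m) i j -
  (\sum_(0 <= m < N.+1) (m`!%:R)^-1 *: A ^+ m
     - (1 + N%:R^-1 *: A) ^+ N) i j @[N --> \oo] --> L i j - 0.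
  apply: cvgB.
    by have := EL i j; rewrite -cvg_shiftS.
  apply: norm_cvg0; apply: (squeeze_cvgr _ (cvg_cst 0) dom0).
  by near=> N; rewrite normr_ge0 mxexp_sub_exprmx_le.
by under eq_fun do rewrite !mxE opprB addrC subrK.
Unshelve. all: by end_near. Qed.

Lemma det_mxexp A L :
  (forall i j, (\sum_(0 <= m < N) (m`!%:R)^-1 *: A ^+ m) i j
     @[N --> \oo] --> L i j) ->
  \det L = expR (\tr A).
Proof.
move=> /cvg_exprmx /cvg_det detL.
apply/esym/(cvg_unique _ _ detL) => //.
have [r [r0 rE]] := det_1DZ A.
have detX (B : 'M[R]_n) k : \det (B ^+ k) = \det B ^+ k.
  elim: k => [|k IHk]; first by rewrite !expr0 det1.
  by rewrite !exprS -IHk -det_mulmx.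
have -> : (fun N => \det ((1 + N%:R^-1 *: A) ^+ N)) =
    (fun N => (1 + N%:R^-1 * r.[N%:R^-1]) ^+ N).
  (* At [N = 0], where [0^-1 = 0] rules out [det_1DZ], both sides come from zeroth powers and equal
     1. *)
  apply/funext => -[|N]; first by rewrite !expr0 det1.
  by rewrite -rE ?invr_eq0 ?pnatr_eq0// detX.
apply: cvg_onePXn; rewrite -cvg_shiftS /=.
under eq_fun do rewrite mulrA mulfV ?mul1r//.
rewrite -r0; apply: continuous_cvg; first exact: continuous_horner.
exact: cvg_harmonic.
Qed.

End MatrixExponential.

(** * The exponential of [{poly %/ h}], through the regular representation *)

Section QuotientExponential.
Context (R : realType) (h : {poly R}).
Local Notation d := (size (mk_monic h)).-1.
Implicit Types z w : {poly %/ h}.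

Lemma prednK_size_mk_monic : d.+1 = size (mk_monic h).
Proof. by rewrite prednK ?size_mk_monic_gt0. Qed.

Lemma size_mk_monic_pred_gt0 : (0 < d)%N.
Proof. by rewrite -ltnS prednK_size_mk_monic size_mk_monic_gt1. Qed.

Lemma qX_expE l : 'qX ^+ l = in_qpoly h 'X^l.
Proof. by rewrite rmorphXn. Qed.

Lemma coef_qX_exp (l i : nat) :
  (l < d)%N -> ('qX ^+ l : {poly %/ h})`_i = (i == l)%:R.
Proof.
move=> ld; rewrite qX_expE in_qpoly_small ?coefXn//.
by rewrite size_polyXn -prednK_size_mk_monic ltnS.
Qed.

Lemma qpoly_sum_qX z : z = \sum_(l < d) z`_l *: 'qX ^+ l.
Proof.
apply/val_inj/polyP => i; rewrite /= coefn_sum.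
have [id|di] := ltnP i d; last first.
  by rewrite big_coef_npoly// big1// => l _; rewrite big_coef_npoly.
rewrite (bigD1 (Ordinal id))//= coefZ coef_qX_exp// eqxx mulr1 big1 ?addr0//.
move=> l; rewrite -val_eqE /= eq_sym => /negPf li.
by rewrite coefZ coef_qX_exp// li mulr0.
Qed.

Lemma mulmat1 : mulmat d (1 : {poly %/ h}) = 1%:M.
Proof. by apply/matrixP => i j; rewrite !mxE mul1r coef_qX_exp. Qed.

(** Expand [w * k^j] in the basis and multiply by [z]. Multiplicativity lets powers, hence the
    partial sums of the exponential, pass to matrices. *)
Lemma mulmatM z w : mulmat d (z * w) = mulmat d z *m mulmat d w.
Proof.
apply/matrixP => i j; rewrite !mxE -mulrA [w * _]qpoly_sum_qX big_distrr/=.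
rewrite coefn_sum; apply: eq_bigr => l _.
by rewrite !mxE -scalerAr coefZ mulrC.
Qed.

Lemma mulmatX z m : mulmat d (z ^+ m) = mulmat d z ^+ m.
Proof.
elim: m => [|m IHm]; first by rewrite !expr0 mulmat1.
by rewrite !exprS mulmatM IHm.
Qed.

Lemma mulmat_qexp_partial z N :
  mulmat d (qexp_partial z N) =
  \sum_(0 <= m < N) (m`!%:R)^-1 *: mulmat d z ^+ m.
Proof.
apply/matrixP => i j; rewrite mxE summxE /qexp_partial big_distrl/= coefn_sum.
by apply: eq_bigr => m _; rewrite -mulmatX !mxE -scalerAl coefZ.
Qed.

(** Since [k^0 = 1], convergence of matrix entries yields convergence of coordinates. *)
Lemma coef_mulmat z i (id : (i < d)%N) :
  z`_i = mulmat d z (Ordinal id) (Ordinal size_mk_monic_pred_gt0).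
Proof. by rewrite mxE expr0 mulr1. Qed.

(** The [lim] in [qexp] is a true limit only once convergence is known; this comes from the matrix
    exponential series. *)
Lemma cvg_qexp z i : (qexp_partial z N)`_i @[N --> \oo] --> (qexp z)`_i.
Proof.
have [id|di] := ltnP i d; last first.
  under eq_fun do rewrite big_coef_npoly//.
  by rewrite big_coef_npoly//; exact: cvg_cst.
have cvgi (k : 'I_d) : cvgn (fun N => (qexp_partial z N)`_k).
  under eq_fun do rewrite (coef_mulmat _ (ltn_ord k)) mulmat_qexp_partial.
  exact: is_cvg_mxexp_coord.
have rVcvg : npoly_rV (qexp_partial z N) @[N --> \oo] -->
    \row_k limn (fun N => (qexp_partial z N)`_k).
  apply: cvg_mx => a k; rewrite mxE.
  by under eq_fun do rewrite /= mxE; exact: cvgi.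
rewrite /qexp (cvg_lim _ rVcvg)//.
rewrite /= val_insubd [_ \is a _]size_poly -[i]/(val (Ordinal id)).
by rewrite coef_rVpoly_ord mxE; exact: (cvgi (Ordinal id)).
Qed.

(** The entries of [mulmat d w] are linear in the coordinates of [w], so [cvg_qexp] supplies the
    convergence that [det_mxexp] asks for. *)
Lemma det_mulmat_qexp z : \det (mulmat d (qexp z)) = expR (\tr (mulmat d z)).
Proof.
apply: det_mxexp => i j.
under eq_fun do rewrite -mulmat_qexp_partial mxE.
have mulmatE w : (w * 'qX ^+ j)`_i =
    \sum_(l < d) w`_l * ('qX ^+ l * 'qX ^+ j : {poly %/ h})`_i.
  rewrite {1}(qpoly_sum_qX w) big_distrl/= coefn_sum.
  by apply: eq_bigr => l _; rewrite -scalerAl coefZ.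
under eq_fun do rewrite mulmatE.
rewrite mxE mulmatE; apply: cvg_big => [|l _]; first exact: add_continuous.
by apply: cvgM; [exact: cvg_qexp|exact: cvg_cst].
Qed.

End QuotientExponential.

(** * The trace when [k^n] is a real constant, and the conclusion *)

Lemma mxtrace_mulmat (R : realType) (n : nat) (c : R) (h : {poly R})
    (z : {poly %/ h}) :
  (0 < n)%N -> h = 'X^n - c%:P -> mk_monic h = h ->
  \tr (mulmat n z) = n%:R * qRe z.
Proof.
move=> n0 hE hK.
have dE : (size (mk_monic h)).-1 = n.
  by rewrite hK hE size_XnsubC.
have qXn : 'qX ^+ n = qpolyC h c.
  have h0 : in_qpoly h h = 0.
    by apply: val_inj; rewrite /= hK Pdiv.RingMonic.rmodpp// -hK monic_mk_monic.
  rewrite qX_expE -[X in in_qpoly h X](subrK c%:P) -hE.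
  rewrite in_qpolyD h0 add0r; apply: val_inj; apply: in_qpoly_small.
  rewrite -[ltnRHS]prednK ?size_mk_monic_gt0// dE ltnS.
  exact: leq_trans (size_polyC_leq1 _) n0.
have diag (j : 'I_n) : (z * 'qX ^+ j)`_j = z`_0.
  rewrite {1}(qpoly_sum_qX z) big_distrl/= coefn_sum.
  rewrite (bigD1 (Ordinal (size_mk_monic_pred_gt0 h)))// big1.
    by rewrite expr0 -scalerAl mul1r coefZ coef_qX_exp ?dE// eqxx mulr1 [LHS]addr0.
  (* For [0 < l], [k^(l+j)] is a basis element of index above [j] or wraps around to [c k^(l+j-n)],
     of index below [j]; neither meets the diagonal. *)
  move=> l /andP[_ l_neq0]; have l0 : (0 < l)%N by rewrite lt0n.
  have ln : (l < n)%N by rewrite -[ltnRHS]dE.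
  rewrite -scalerAl coefZ -exprD; have [ljn|nlj] := ltnP (l + j) n.
    rewrite coef_qX_exp; last by rewrite [ltnRHS]dE.
    by rewrite ltn_eqF ?mulr0// -[ltnLHS]add0n ltn_add2r.
  rewrite -(subnK nlj) exprD qXn.
  have -> w : w * qpolyC h c = c *: w.
    rewrite mulrC (_ : qpolyC h c = c *: 1) -?scalerAl ?mul1r//.
    by apply: val_inj; rewrite /= alg_polyC.
  have ltj : (l + j - n < j)%N by rewrite ltn_subLR// ltn_add2r.
  rewrite coefZ coef_qX_exp; last by rewrite [ltnRHS]dE (ltn_trans ltj).
  by rewrite gtn_eqF// !mulr0.
rewrite /mxtrace; under eq_bigr do rewrite mxE diag.
by rewrite sumr_const card_ord mulr_natl.
Qed.

Theorem theorem2p8 (R : realType) (n : nat) (hn : (0 < n)%N) (h : {poly R})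
    (hA : h = 'X^n + 1 \/ h = 'X^n - 1 \/ h = 'X^n)
    (X : set {poly %/ h}) (hX : X `<=` Ld h)
    (Log : {poly %/ h} -> {poly %/ h})
    (hLog : forall z, X z -> qexp (Log z) = z) :
  forall z, X z -> qRe (Log z) = ln (modulus n z).
Proof.
have [c [hE hK]] : exists c : R, h = 'X^n - c%:P /\ mk_monic h = h.
  case: hA => [->|[->|->]].
  - by exists (-1); rewrite polyCN opprK; split => //; exact: mk_monicXn_add1.
  - by exists 1; split => //; exact: mk_monicXn_sub1.
  - by exists 0; rewrite polyC0 subr0; split => //; exact: mk_monicXn.
have dE : (size (mk_monic h)).-1 = n by rewrite hK hE size_XnsubC.
move=> z Xz; rewrite -[in RHS](hLog z Xz) /modulus /qdet.
have -> : \det (mulmat n (qexp (Log z))) = expR (\tr (mulmat n (Log z))).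
  by have := det_mulmat_qexp (Log z); rewrite dE.
(* Under [ln] the n-th root becomes the factor [1/n], which cancels the [n] of the trace. *)
rewrite (mxtrace_mulmat _ hn hE hK) ln_powR expRK mulrA mulVf ?mul1r//.
by rewrite pnatr_eq0 -lt0n.
Qed.
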